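(* Let $W\subset\mathbb{R}^2$ be a compact convex domain with non-empty interior. For every integer $k\ge 2$ there are sets of $k$ lines such that the number of T-tessellations of $W$ on those lines is at least $\left(\frac{k}{\ln k}\right)^{k-k/(\ln k)}$; in particular $$\mathcal{N}(k)=\sup_{L:\ \#L=k}\#\mathcal{T}(L)\ \ge\ \left(\frac{k}{\ln k}\right)^{k-k/(\ln k)}.$$
   Context: Let $W$ be a compact convex domain in the plane with non-empty interior and boundary $\mathcal{B}$. A finite polygonal tessellation of $W$ is a finite partition of $W$ into convex sets with disjoint interiors, called cells, such that the boundary of each cell is a union of a finite number of line segments, called (inner) edges, and of parts of the boundary $\mathcal{B}$ of $W$. A segment of the tessellation is a maximal union of aligned and contiguous inner edges. A vertex is T-shaped if it has degree three and two of the incident edges are aligned, or if it has degree one and lies on $\mathcal{B}$ (only inner edges are counted in the degree of a vertex on $\mathcal{B}$). A T-tessellation is a polygonal tessellation such that all vertices in $W$ are T-shaped and no two segments are aligned. For a T-tessellation $T$, $L(T)$ denotes the set of lines supporting the segments of $T$. For a finite set $L$ of lines, $\mathcal{T}(L)=\{T: L(T)=L\}$ is the set of T-tessellations of $W$ whose segments are supported by $L$, with exactly one segment on each line of $L$. The supremum is over all sets $L$ of $k$ distinct lines. *)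

(* Defs.v *)
From HB Require Import structures.
From mathcomp Require Import all_boot all_order all_algebra.
From mathcomp Require Import all_classical all_reals all_analysis.

Set Implicit Arguments.
Unset Strict Implicit.
Unset Printing Implicit Defensive.

Import Order.TTheory GRing.Theory Num.Theory.
Import numFieldNormedType.Exports.

Local Open Scope classical_set_scope.
Local Open Scope card_scope.
Local Open Scope ring_scope.
Local Open Scope convex_scope.

(* A tessellation of W is represented by its set of cells,
   T : set (set (plane R)). Edges, vertices, segments and supporting lines are
   all determined by the cells, so counting tessellations means counting such
   sets T. *)

Notation plane R := (R^o * R^o)%type (only parsing).

Definition boundary (R : realType) (A : set (plane R)) : set (plane R) :=
  closure A `\` A°.

Definition is_line (R : realType) (l : set (plane R)) : Prop :=
  exists a b c : R,
    (a, b) <> (0, 0) /\ l = [set p | a * p.1 + b * p.2 = c].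

Definition segment_between (R : realType) (p q : plane R) : set (plane R) :=
  [set (p : convex_lmodType (plane R)) <| t |> q | t in [set: {i01 R}]].

Definition has_ends (R : realType) (e : set (plane R)) (p q : plane R) : Prop :=
  p <> q /\ e = segment_between p q.

Definition aligned (R : realType) (s1 s2 : set (plane R)) : Prop :=
  exists l, [/\ is_line l, s1 `<=` l & s2 `<=` l].

(* An inner edge is a non-degenerate segment along which two distinct cells
   meet. Hence a side of a cell is cut into several edges at the vertices in
   its relative interior: a vertex where one segment abuts on another has
   degree three, two of its edges being aligned. *)
Definition inner_edges (R : realType) (T : set (set (plane R)))
    : set (set (plane R)) :=
  [set e | (exists p q, has_ends e p q) /\
           exists c d, [/\ T c, T d, c <> d & e = c `&` d]].

(* Cells are taken closed and with non-empty interior: otherwise, as the cells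
   are only required to have disjoint interiors, modifying them on their
   boundaries would give infinitely many versions of the same tessellation. *)
Definition polygonal_tessellation (R : realType) (W : set (plane R))
    (T : set (set (plane R))) : Prop :=
  [/\ finite_set T,
      \bigcup_(c in T) c = W,
      (forall c, T c -> [/\ closed c, convex_set c & c° !=set0]),
      trivIset T (fun c => c°) &
      forall c, T c -> exists (E : set (set (plane R))) (b : set (plane R)),
        [/\ finite_set E, E `<=` inner_edges T, b `<=` boundary W &
            boundary c = \bigcup_(e in E) e `|` b]].

Definition incident_edges (R : realType) (T : set (set (plane R)))
    (v : plane R) : set (set (plane R)) :=
  [set e | inner_edges T e /\ exists q, has_ends e v q].

(* The corners of W which are not an end of an inner edge are not vertices. *)
Definition is_vertex (R : realType) (T : set (set (plane R))) (v : plane R)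
    : Prop :=
  incident_edges T v !=set0.

Definition T_shaped (R : realType) (W : set (plane R))
    (T : set (set (plane R))) (v : plane R) : Prop :=
  (incident_edges T v #= `I_3 /\
   exists e1 e2, [/\ incident_edges T v e1, incident_edges T v e2,
                     e1 <> e2 & aligned e1 e2])
  \/ (incident_edges T v #= `I_1 /\ boundary W v).

Definition aligned_contiguous (R : realType) (T : set (set (plane R)))
    (F : set (set (plane R))) : Prop :=
  [/\ F `<=` inner_edges T, F !=set0,
      (exists2 l, is_line l & forall e, F e -> e `<=` l) &
      connected (\bigcup_(e in F) e)].

Definition is_segment (R : realType) (T : set (set (plane R)))
    (s : set (plane R)) : Prop :=
  exists F, [/\ aligned_contiguous T F, s = \bigcup_(e in F) e &
    forall F', aligned_contiguous T F' -> F `<=` F' -> F' = F].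

Definition T_tessellation (R : realType) (W : set (plane R))
    (T : set (set (plane R))) : Prop :=
  [/\ polygonal_tessellation W T,
      (forall v, is_vertex T v -> T_shaped W T v) &
      forall s1 s2, is_segment T s1 -> is_segment T s2 -> s1 <> s2 ->
        ~ aligned s1 s2].

Definition supporting_lines (R : realType) (T : set (set (plane R)))
    : set (set (plane R)) :=
  [set l | is_line l /\ exists2 s, is_segment T s & s `<=` l].

(* As no two segments of a T-tessellation are aligned, each line of L supports
   exactly one segment. *)
Definition T_tessellations_on (R : realType) (W : set (plane R))
    (L : set (set (plane R))) : set (set (set (plane R))) :=
  [set T | T_tessellation W T /\ supporting_lines T = L].

Definition line_sets (R : realType) (k : nat) : set (set (set (plane R))) :=
  [set L | (forall l, L l -> is_line l) /\ L #= `I_k].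

(* `counting` is the number of elements of a set, +oo if the set is infinite. *)
Definition max_T_tessellations (R : realType) (W : set (plane R)) (k : nat)
    : \bar R :=
  ereal_sup [set counting (T_tessellations_on W L) | L in line_sets k].

(* Main.v *)
Require Import Defs.
From HB Require Import structures.
From mathcomp Require Import all_boot all_order all_algebra.
From mathcomp Require Import all_classical all_reals all_analysis.
From mathcomp Require Import ring lra.
Import Order.TTheory GRing.Theory Num.Theory.
Import numFieldNormedType.Exports.
Local Open Scope classical_set_scope.
Local Open Scope ring_scope.

Set Implicit Arguments.
Unset Strict Implicit.
Unset Printing Implicit Defensive.

(** Take [m] horizontal and [n] vertical lines, all of whose crossings lie in an
    open rectangle (the core) contained in the interior of [W]. The horizontal
    lines cut [W] into [m + 1] strips. Keep the whole chord cut by [W] on every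
    horizontal line and, for every vertical line, keep only the piece that
    crosses one strip, chosen freely. As the vertical lines are parallel, the
    kept pieces do not meet each other; each of them abuts on a horizontal chord
    or on the boundary of [W] at both ends, so that a T-tessellation is obtained,
    with exactly one segment on each line. Different choices give different
    tessellations, hence there are at least [(m + 1) ^ n] T-tessellations on
    these [n + m] lines ([many_T_tessellations]). With [K = k / ln k], [m] the
    integer part of [K] and [n = k - m], one has [m <= K < m + 1], and
    [(m + 1) ^ n] is at least [K ^ (k - K)] ([grid_size_exists]).

    All cells and edges of such a tessellation are intersections of [W] with
    possibly degenerate rectangles ([cell]). Surrounding [W] by a large square
    with sides [lo] and [hi], and adding these two numbers to the ordinates of
    the horizontal lines and to the abscissae of the cuts in each strip, every
    cell is delimited by two consecutive ordinates and two consecutive abscissae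
    in each direction, with no special treatment of the cells that touch the
    boundary of [W] ([layout], [tessellation]). The core guarantees that any two
    consecutive values bound a rectangle which meets the interior of [W].

    The main step is the list of the inner edges ([inner_edgesP]): the pieces of
    vertical lines that were kept, and the pieces of a horizontal line between
    two consecutive abscissae among the cuts of the two adjacent strips. An end
    of an edge in the interior of [W] is therefore the foot of a cut on a
    horizontal line, where exactly two collinear edges and the cut meet
    ([incident_grid]), because no vertical line is cut in two strips; an end on
    the boundary belongs to a single edge ([boundary_edge_unique]). Finally, the
    edges on a given line have a connected union, which implies that it supports
    a single segment ([aligned_segments_eq], [supporting_linesE]). *)

(** * Segments, lines and interiors in the plane *)

Section PlaneGeometry.
Context {R : realType}.
Implicit Types (A C l e : set (plane R)) (p q r v : plane R).

Lemma interior_planeP A p : A° p <->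
  exists2 eps : R, 0 < eps &
    forall q, `|q.1 - p.1| < eps -> `|q.2 - p.2| < eps -> A q.
Proof.
rewrite /interior; split.
  move/nbhs_ballP => [eps /= eps0 epsA]; exists eps => // q q1 q2.
  by apply: epsA; split; rewrite -ball_normE /ball_ /= distrC.
move=> [eps eps0 epsA]; apply/nbhs_ballP; exists eps => //= q [].
by rewrite -!ball_normE /ball_ /= ![`|p.1 - _|]distrC ![`|p.2 - _|]distrC; exact: epsA.
Qed.

Lemma segment_betweenP p q r : segment_between p q r <->
  exists t : R, [/\ 0 <= t <= 1, r.1 = t * p.1 + (1 - t) * q.1 &
                                 r.2 = t * p.2 + (1 - t) * q.2].
Proof.
split=> [[t _ <-]|[t [t01 r1 r2]]].
  by exists t%:num; split; [apply/andP; split; [exact: ge0|exact: le1]| |].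
case/andP: t01 => t0 t1.
have t01 : Itv.spec (@Itv.num_sem R) (Itv.Real `[0%Z, 1%Z]) t.
  by rewrite /= /Itv.num_sem/= num_real/= in_itv/= t0 t1.
exists (Itv.mk t01) => //.
by case: r r1 r2 => /= r1 r2 -> ->.
Qed.

Lemma convex_setP A : convex_set A <->
  forall p q, A p -> A q -> segment_between p q `<=` A.
Proof.
split=> [cA p q Ap Aq _ [t _ <-]|cA p q t /[!inE] Ap Aq].
  by have := cA p q t; rewrite !inE; apply.
by apply: (cA p q) => //; exists t.
Qed.

Lemma continuous_affine (a b : R) : continuous (fun p : plane R => a * p.1 + b * p.2).
Proof.
move=> p; apply: cvgD; apply: cvgM; try exact: cvg_cst.
  exact: cvg_fst.
exact: cvg_snd.
Qed.

Lemma connected_segment p q : connected (segment_between p q).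
Proof.
have -> : segment_between p q =
    (fun t : R => (t * p.1 + (1 - t) * q.1, t * p.2 + (1 - t) * q.2) : plane R)
      @` `[0, 1]%classic.
  apply/seteqP; split=> [r /segment_betweenP[t [t01 r1 r2]]|_ [t t01 <-]].
    exists t; first by rewrite /= in_itv.
    by case: r r1 r2 => /= ? ? -> ->.
  by apply/segment_betweenP; exists t; split => //; move: t01; rewrite /= in_itv.
apply: connected_continuous_connected; first exact: segment_connected.
apply: continuous_subspaceT => t.
have c (u w : R) : {for t, continuous (fun s : R => s * u + (1 - s) * w)}.
  apply: cvgD; apply: cvgM; try exact: cvg_cst; first exact: cvg_id.
  by apply: cvgB; [exact: cvg_cst | exact: cvg_id].
exact: (cvg_pair (c p.1 q.1) (c p.2 q.2)).
Qed.

(** The linear form [a, b] serves as a coordinate on the line that carries [C]: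
    being injective on [C], it identifies [C] with a compact interval, and a
    minimum of it is an end of [C]. *)
Lemma extreme_has_ends C v r (a b : R) : compact C -> convex_set C ->
  (forall p q, C p -> C q -> a * p.1 + b * p.2 = a * q.1 + b * q.2 -> p = q) ->
  C v -> (forall p, C p -> a * v.1 + b * v.2 <= a * p.1 + b * p.2) ->
  C r -> r <> v -> exists q, has_ends C v q.
Proof.
move=> cC convC inj Cv vmin Cr rv.
pose f p : R := a * p.1 + b * p.2.
have [q Cq qmax] := @compact_EVT_max _ R f C (ex_intro _ v Cv) cC
  (continuous_subspaceT (@continuous_affine a b)).
have fv : f v < f q.
  rewrite lt_neqAle (vmin q) ?inE// ?andbT; last by move: Cq; rewrite inE.
  apply/eqP => fvq; apply: rv; apply: inj => //.
  apply/eqP; rewrite eq_le (vmin r)// andbT -/(f v) fvq; apply: qmax.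
  by rewrite inE.
have {}Cq : C q by move: Cq; rewrite inE.
exists q; split=> [vq|]; first by move: fv; rewrite vq ltxx.
apply/seteqP; split=> [p Cp|]; last exact: (convex_setP C).1.
have fp1 : f v <= f p by exact: vmin.
have fp2 : f p <= f q by apply: qmax; rewrite inE.
have D0 : 0 < f q - f v by rewrite subr_gt0.
have /segment_betweenP S : exists t : R, [/\ 0 <= t <= 1,
    (p.1 : R) = t * v.1 + (1 - t) * q.1 & (p.2 : R) = t * v.2 + (1 - t) * q.2].
  (* the barycentric coordinate of [p] read on the form; injectivity then shows
     that [p] is the point with this coordinate *)
  pose t := (f q - f p) / (f q - f v).
  have t01 : 0 <= t <= 1.
    apply/andP; split; first by rewrite divr_ge0 ?(ltW D0)// subr_ge0.
    by rewrite /t ler_pdivrMr// mul1r lerD2l lerN2.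
  pose s : plane R := (t * v.1 + (1 - t) * q.1, t * v.2 + (1 - t) * q.2).
  have Cs : C s.
    by apply: ((convex_setP C).1 convC _ _ Cv Cq); apply/segment_betweenP; exists t.
  exists t; suff -> : p = s by [].
  apply: inj => //; rewrite -/(f p) -/(f s).
  have -> : f s = t * f v + (1 - t) * f q by rewrite /f /s /=; ring.
  have tD : t * (f q - f v) = f q - f p by rewrite /t mulfVK// gt_eqF.
  by lra.
exact: S.
Qed.

(** An end is an extreme point. This is how the ends of an edge are located: a
    point around which the edge extends on both sides is not one of them. *)
Lemma has_ends_extreme e v q (w1 w2 : R) : has_ends e v q ->
  e (v.1 + w1, v.2 + w2) -> e (v.1 - w1, v.2 - w2) -> w1 = 0 /\ w2 = 0.
Proof.
move=> [vq ->] /segment_betweenP[t [/andP[t0 t1] /= a1 a2]].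
move=> /segment_betweenP[s [/andP[s0 s1] /= b1 b2]].
pose u := 2 - t - s.
have e1 : u * (q.1 - v.1) = 0 by rewrite /u; lra.
have e2 : u * (q.2 - v.2) = 0 by rewrite /u; lra.
have [u0|u0] := eqVneq u 0.
  have t1' : t = 1 by move: u0; rewrite /u; lra.
  by move: a1 a2; rewrite t1'; lra.
exfalso; apply: vq.
move/eqP: e1; rewrite mulf_eq0 (negbTE u0)/= subr_eq0 => /eqP e1.
move/eqP: e2; rewrite mulf_eq0 (negbTE u0)/= subr_eq0 => /eqP e2.
by case: (v) (q) e1 e2 => ? ? [? ?] /= -> ->.
Qed.

Lemma has_ends_left e v q : has_ends e v q -> e v.
Proof.
move=> [_ ->]; apply/segment_betweenP; exists 1.
by rewrite ler01 lexx; split => //; ring.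
Qed.

Lemma has_ends_right e v q : has_ends e v q -> e q.
Proof.
move=> [_ ->]; apply/segment_betweenP; exists 0.
by rewrite ler01 lexx; split => //; ring.
Qed.

Lemma line_unique l l' p q : is_line l -> is_line l' -> p <> q ->
  l p -> l q -> l' p -> l' q -> l = l'.
Proof.
suff H l1 l2 : is_line l1 -> is_line l2 -> p <> q ->
    l1 p -> l1 q -> l2 p -> l2 q -> l1 `<=` l2.
  by move=> *; apply/seteqP; split; apply: H.
move=> [a [b [c [ab ->]]]] [a' [b' [c' [_ ->]]]] pq /= p1 q1 p2 q2 r /= r1.
have ab0 : a ^+ 2 + b ^+ 2 != 0.
  apply/eqP => ab0; apply: ab.
  have a0 : a = 0 by apply/eqP; rewrite -sqrf_eq0; apply/eqP; nra.
  by rewrite a0; congr pair; apply/eqP; rewrite -sqrf_eq0; apply/eqP; nra.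
(* the determinant of the two normal vectors, which kills [p - q] *)
pose x := a' * b - a * b'.
have x0 : x = 0.
  apply/eqP; apply: contrapT => /negP x0; apply: pq.
  have d1 : x * (p.1 - q.1) = 0.
    have -> : x * (p.1 - q.1) = b * ((a' * p.1 + b' * p.2) - (a' * q.1 + b' * q.2))
       - b' * ((a * p.1 + b * p.2) - (a * q.1 + b * q.2)) by rewrite /x; ring.
    by rewrite p1 q1 p2 q2; ring.
  have d2 : x * (p.2 - q.2) = 0.
    have -> : x * (p.2 - q.2) = a' * ((a * p.1 + b * p.2) - (a * q.1 + b * q.2))
       - a * ((a' * p.1 + b' * p.2) - (a' * q.1 + b' * q.2)) by rewrite /x; ring.
    by rewrite p1 q1 p2 q2; ring.
  move/eqP: d1; rewrite mulf_eq0 (negbTE x0)/= subr_eq0 => /eqP e1.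
  move/eqP: d2; rewrite mulf_eq0 (negbTE x0)/= subr_eq0 => /eqP e2.
  by case: (p) (q) e1 e2 => ? ? [? ?] /= -> ->.
apply: (mulfI ab0); apply/eqP; rewrite -subr_eq0; apply/eqP.
rewrite -p2 -mulrBr.
have -> : (a ^+ 2 + b ^+ 2) * (a' * r.1 + b' * r.2 - (a' * p.1 + b' * p.2)) =
  (a * a' + b * b') * ((a * r.1 + b * r.2) - (a * p.1 + b * p.2))
   + x * (b * (r.1 - p.1) - a * (r.2 - p.2)) by rewrite /x; ring.
by rewrite r1 p1 x0; ring.
Qed.

Definition vertical_line (a : R) : set (plane R) := [set p | p.1 = a].
Definition horizontal_line (d : R) : set (plane R) := [set p | p.2 = d].

Lemma is_line_vertical a : is_line (vertical_line a).
Proof.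
exists 1, 0, a; split; first by move=> [/eqP]; rewrite oner_eq0.
by apply/seteqP; split=> p /=; rewrite /vertical_line/= mul1r mul0r addr0.
Qed.

Lemma is_line_horizontal d : is_line (horizontal_line d).
Proof.
exists 0, 1, d; split; first by move=> [/eqP]; rewrite oner_eq0.
by apply/seteqP; split=> p /=; rewrite /horizontal_line/= mul1r mul0r add0r.
Qed.

End PlaneGeometry.

(** * Consecutive members of a finite set of reals *)

Section Consecutive.
Context {R : realType}.
Implicit Types (X Y : seq R) (a b x z : R).

Definition consecutive X a b :=
  [/\ a \in X, b \in X, a < b & forall z, z \in X -> (z <= a) || (b <= z)].

Lemma seq_max X (P : pred R) z : z \in X -> P z ->
  exists m, [/\ m \in X, P m & forall y, y \in X -> P y -> y <= m].
Proof.
elim: X z => [//|x X IH] z zX Pz.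
have [/hasP[y yX Py]|/hasPn nP] := boolP (has P X).
  have [m [mX Pm mmax]] := IH y yX Py.
  have [/andP[Px mx]|] := boolP (P x && (m <= x)).
    exists x; split; rewrite ?mem_head// => t; rewrite inE => /orP[/eqP->//|tX Pt].
    by rewrite (le_trans _ mx)// mmax.
  rewrite negb_and -ltNge => h; exists m; split => //; first by rewrite inE mX orbT.
  move=> t; rewrite inE => /orP[/eqP-> Px|]; last exact: mmax.
  by move: h; rewrite Px/= => /ltW.
have zx : z = x.
  by move: zX; rewrite inE => /orP[/eqP//|/nP]; rewrite Pz.
exists x; split; rewrite ?mem_head -?zx// => t; rewrite inE => /orP[/eqP->//|/nP].
by move=> /negbTE->.
Qed.

Lemma seq_min X (P : pred R) z : z \in X -> P z ->
  exists m, [/\ m \in X, P m & forall y, y \in X -> P y -> m <= y].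
Proof.
move=> zX Pz.
have [||m [mX Pm mmax]] := @seq_max (map -%R X) (fun y => P (- y)) (- z).
- exact: map_f.
- by rewrite opprK.
exists (- m); split=> //; first by case/mapP: mX => y yX ->; rewrite opprK.
by move=> y yX Py; rewrite lerNl; apply: mmax; rewrite ?map_f ?opprK.
Qed.

(** The two bracketing lemmas differ by the half-open interval. Both forms are
    needed to get the neighbours of a member of [X] on either side. *)
Lemma consecutive_from X x z1 z2 : z1 \in X -> z2 \in X -> z1 <= x -> x < z2 ->
  exists a b, consecutive X a b /\ a <= x < b.
Proof.
move=> z1X z2X z1x xz2.
have [a [aX ax amax]] := seq_max (P := fun y => y <= x) z1X z1x.
have [b [bX bx bmin]] := seq_min (P := fun y => x < y) z2X xz2.
exists a, b; split; last by rewrite ax bx.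
split=> // [|y yX]; first exact: le_lt_trans bx.
by have [yx|xy] := leP y x; [rewrite amax|rewrite bmin ?orbT].
Qed.

Lemma consecutive_to X x z1 z2 : z1 \in X -> z2 \in X -> z1 < x -> x <= z2 ->
  exists a b, consecutive X a b /\ a < x <= b.
Proof.
move=> z1X z2X z1x xz2.
have [a [aX ax amax]] := seq_max (P := fun y => y < x) z1X z1x.
have [b [bX bx bmin]] := seq_min (P := fun y => x <= y) z2X xz2.
exists a, b; split; last by rewrite ax bx.
split=> // [|y yX]; first exact: lt_le_trans bx.
by have [yx|xy] := ltP y x; [rewrite amax|rewrite bmin ?orbT].
Qed.

Lemma consecutive_succ X z h : z \in X -> h \in X -> z < h ->
  exists b, consecutive X z b.
Proof.
move=> zX hX zh.
have [a [b [ab /andP[az zb]]]] := consecutive_from zX hX (lexx z) zh.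
exists b; suff <- : a = z by [].
by case: ab => _ _ _ /(_ z zX); lra.
Qed.

Lemma consecutive_pred X z l : z \in X -> l \in X -> l < z ->
  exists a, consecutive X a z.
Proof.
move=> zX lX lz.
have [a [b [ab /andP[az zb]]]] := consecutive_to lX zX lz (lexx z).
exists a; suff <- : b = z by [].
by case: ab => _ _ _ /(_ z zX); lra.
Qed.

Lemma consecutive_mem X a b z : consecutive X a b -> z \in X ->
  a <= z <= b -> z = a \/ z = b.
Proof.
move=> [_ _ _ h] /h /orP[za|bz] /andP[az zb].
  by left; apply/eqP; rewrite eq_le za az.
by right; apply/eqP; rewrite eq_le zb bz.
Qed.

Lemma consecutive_disjoint X a b a' b' :
  consecutive X a b -> consecutive X a' b' ->
  (a = a' /\ b = b') \/ (b <= a' \/ b' <= a).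
Proof.
move=> [aX bX ab h] [aX' bX' ab' h'].
have [ba'|a'b] := leP b a'; first by right; left.
have [b'a|ab''] := leP b' a; first by right; right.
left; split; apply/eqP; rewrite eq_le.
  by have := h _ aX'; have := h' _ aX; lra.
by have := h _ bX'; have := h' _ bX; lra.
Qed.

Lemma consecutive_overlap X a b a' b' t :
  consecutive X a b -> consecutive X a' b' -> a < t < b -> a' <= t <= b' ->
  a' = a /\ b' = b.
Proof.
by move=> h h' *; case: (consecutive_disjoint h h') => [[-> ->]//|[]]; lra.
Qed.

Lemma consecutive_left X a b b' :
  consecutive X a b -> consecutive X a b' -> b' = b.
Proof.
move=> h h'; case: (consecutive_disjoint h h') => [[]//|].
by case: h => _ _ h _; case: h' => _ _ h' _; case; lra.
Qed.

Lemma consecutive_right X a a' b :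
  consecutive X a b -> consecutive X a' b -> a' = a.
Proof.
move=> h h'; case: (consecutive_disjoint h h') => [[]//|].
by case: h => _ _ h _; case: h' => _ _ h' _; case; lra.
Qed.

(** Adding points refines the subdivision: an elementary interval of the finer
    set lies in one of the coarser set. *)
Lemma consecutive_sub X Y a b z1 z2 : {subset X <= Y} -> consecutive Y a b ->
  z1 \in X -> z2 \in X -> z1 <= a -> b <= z2 ->
  exists a' b', [/\ consecutive X a' b', a' <= a & b <= b'].
Proof.
move=> XY [_ _ ab h] z1X z2X z1a bz2.
have [||a' [b' [h' /andP[a'a ab']]]] := consecutive_from (x := a) z1X z2X.
- exact: z1a.
- by lra.
exists a', b'; split=> //.
by have [_ /XY/h + _ _] := h'; lra.
Qed.

(** The elementary intervals of a union are the non-degenerate intersections of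
    elementary intervals of the two sets; [consecutive_cat_meet] is the
    converse. Below, they describe how two cells meet along a horizontal line. *)
Lemma consecutive_cat X Y a b a' b' : consecutive X a b -> consecutive Y a' b' ->
  Num.max a a' < Num.min b b' ->
  consecutive (X ++ Y) (Num.max a a') (Num.min b b').
Proof.
move=> [aX bX ab h] [aY bY ab' h'] m; split=> //.
- by rewrite mem_cat; case: leP => _; rewrite ?aX ?aY ?orbT.
- by rewrite mem_cat; case: leP => _; rewrite ?bX ?bY ?orbT.
- move=> z; rewrite mem_cat le_max ge_min => /orP[/h|/h'] /orP[->|->] //;
  by rewrite ?orbT.
Qed.

Lemma consecutive_cat_meet X Y a b a1 b1 a2 b2 : consecutive (X ++ Y) a b ->
  consecutive X a1 b1 -> consecutive Y a2 b2 ->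
  a1 <= a -> b <= b1 -> a2 <= a -> b <= b2 ->
  Num.max a1 a2 = a /\ Num.min b1 b2 = b.
Proof.
move=> [+ + ab _] [_ _ ab1 h1] [_ _ ab2 h2] a1a bb1 a2a bb2.
rewrite !mem_cat => aXY bXY; split; apply/eqP; rewrite eq_le.
  rewrite ge_max a1a a2a/= le_max.
  by case/orP: aXY => [/h1|/h2]; lra.
rewrite le_min bb1 bb2/= ge_min andbT.
by case/orP: bXY => [/h1|/h2]; lra.
Qed.

End Consecutive.

(** * Truncated rectangles *)

Section Cells.
Context {R : realType} (W : set (plane R)).

Definition cell (a b c d : R) : set (plane R) :=
  W `&` [set p | a <= p.1 <= b /\ c <= p.2 <= d].

Lemma cellI a b c d a' b' c' d' :
  cell a b c d `&` cell a' b' c' d' =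
  cell (Num.max a a') (Num.min b b') (Num.max c c') (Num.min d d').
Proof.
apply/seteqP; split=> p.
  move=> [[Wp [/andP[? ?] /andP[? ?]]] [_ [/andP[? ?] /andP[? ?]]]].
  by split=> //; split; apply/andP; split; rewrite ?ge_max ?le_min; apply/andP; split.
move=> [Wp [] /=]; rewrite !ge_max !le_min => /andP[/andP[? ?] /andP[? ?]].
move=> /andP[/andP[? ?] /andP[? ?]].
by split; (split=> //; split; apply/andP; split).
Qed.

Lemma interior_cell a b c d p : (cell a b c d)° p <->
  [/\ W° p, a < p.1 < b & c < p.2 < d].
Proof.
split=> [/interior_planeP[e e0 h]|[/interior_planeP[e e0 h] ab cd]].
  have hx (s : R) : `|s| < e -> a <= p.1 + s <= b.
    move=> se; have [|/=|_ []//] := h (p.1 + s, p.2) => /=.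
      by rewrite addrAC subrr add0r.
    by rewrite subrr normr0.
  have hy (s : R) : `|s| < e -> c <= p.2 + s <= d.
    move=> se; have [|/=|_ []//] := h (p.1, p.2 + s) => /=.
      by rewrite subrr normr0.
    by rewrite addrAC subrr add0r.
  have e2 : `|e / 2| < e by rewrite ger0_norm; lra.
  have Ne2 : `|- (e / 2)| < e by rewrite normrN.
  split; first by apply/interior_planeP; exists e => // q q1 q2; case: (h q q1 q2).
    by have := hx _ e2; have := hx _ Ne2; lra.
  by have := hy _ e2; have := hy _ Ne2; lra.
pose m := Num.min e (Num.min (Num.min (p.1 - a) (b - p.1))
                             (Num.min (p.2 - c) (d - p.2))).
apply/interior_planeP; exists m => [|q].
  by rewrite !lt_min e0/=; lra.
rewrite !lt_min !ltr_norml => q1 q2; split; last by split; lra.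
by apply: h; rewrite ltr_norml; lra.
Qed.

Hypotheses (W_compact : compact W) (W_convex : convex_set W).

Lemma convex_cell a b c d : convex_set (cell a b c d).
Proof.
apply/convex_setP => p q [Wp [p1 p2]] [Wq [q1 q2]] r pqr; split.
  exact: (convex_setP W).1 pqr.
move: pqr => /segment_betweenP[s [/andP[s0 s1] r1 r2]] /=; rewrite r1 r2.
move: p1 p2 q1 q2 => /andP[? ?] /andP[? ?] /andP[? ?] /andP[? ?].
by split; apply/andP; split; nra.
Qed.

Lemma compact_cell a b c d : compact (cell a b c d).
Proof.
apply: compact_closedI => //.
have -> : [set p : plane R | a <= p.1 <= b /\ c <= p.2 <= d] =
    (fst @^-1` `[a, b]%classic) `&` (snd @^-1` `[c, d]%classic).
  by apply/seteqP; split=> p /=; rewrite !in_itv.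
apply: closedI; apply: preimage_closed.
- by move=> x _; exact: cvg_fst.
- exact: interval_closed.
- by move=> x _; exact: cvg_snd.
- exact: interval_closed.
Qed.

Lemma closed_cell a b c d : closed (cell a b c d).
Proof. by apply: compact_closed; [exact: norm_hausdorff|exact: compact_cell]. Qed.

(** The sign of [y'] selects the lower or the upper end. *)
Lemma has_ends_vertical_cell a c d y y' (v : plane R) :
  cell a a c d v -> cell a a c d (a, y) -> y <> v.2 ->
  (forall y, cell a a c d (a, y) -> y' * v.2 <= y' * y) -> y' != 0 ->
  exists q, has_ends (cell a a c d) v q.
Proof.
move=> Cv Cy yv vmin y'0.
have onl p : cell a a c d p -> p.1 = a by move=> [_ [] /=]; lra.
apply: (@extreme_has_ends _ _ v (a, y) 0 y').
- exact: compact_cell.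
- exact: convex_cell.
- move=> p q Cp Cq; rewrite !mul0r !add0r => /(mulfI y'0).
  by case: p q Cp Cq => [p1 p2] [q1 q2] /onl/= -> /onl/= -> ->.
- exact: Cv.
- move=> p Cp; rewrite !mul0r !add0r; apply: vmin.
  suff -> : (a, p.2) = p by [].
  by rewrite -(onl _ Cp) -surjective_pairing.
- exact: Cy.
- by move=> vE; apply: yv; rewrite -vE.
Qed.

(** The sign of [x'] selects the left or the right end. *)
Lemma has_ends_horizontal_cell a b d x x' (v : plane R) :
  cell a b d d v -> cell a b d d (x, d) -> x <> v.1 ->
  (forall x, cell a b d d (x, d) -> x' * v.1 <= x' * x) -> x' != 0 ->
  exists q, has_ends (cell a b d d) v q.
Proof.
move=> Cv Cx xv vmin x'0.
have onl p : cell a b d d p -> p.2 = d by move=> [_ [] /=]; lra.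
apply: (@extreme_has_ends _ _ v (x, d) x' 0).
- exact: compact_cell.
- exact: convex_cell.
- move=> p q Cp Cq; rewrite !mul0r !addr0 => /(mulfI x'0).
  by case: p q Cp Cq => [p1 p2] [q1 q2] /onl/= -> /onl/= -> ->.
- exact: Cv.
- move=> p Cp; rewrite !mul0r !addr0; apply: vmin.
  suff -> : (p.1, d) = p by [].
  by rewrite -(onl _ Cp) -surjective_pairing.
- exact: Cx.
- by move=> vE; apply: xv; rewrite -vE.
Qed.

Lemma vertical_cell_has_ends a c d y1 y2 : cell a a c d (a, y1) -> cell a a c d (a, y2) ->
  y1 <> y2 -> exists p q, has_ends (cell a a c d) p q.
Proof.
move=> C1 C2 y12.
have [v /[!inE] Cv vmin] := @compact_EVT_min _ R snd (cell a a c d)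
  (ex_intro _ _ C1) (@compact_cell a a c d) (continuous_subspaceT (fun p => cvg_snd)).
have Ev y : cell a a c d (a, y) -> 1 * v.2 <= 1 * y.
  by move=> Cy; rewrite !mul1r; apply: (vmin (a, y)); rewrite inE.
exists v; have [y1v|/eqP y1v] := eqVneq y1 v.2.
  apply: (has_ends_vertical_cell Cv C2 _ Ev) (oner_neq0 _).
  by move=> y2v; apply: y12; rewrite y1v.
exact: (has_ends_vertical_cell Cv C1 y1v Ev) (oner_neq0 _).
Qed.

Lemma horizontal_cell_has_ends a b d x1 x2 : cell a b d d (x1, d) -> cell a b d d (x2, d) ->
  x1 <> x2 -> exists p q, has_ends (cell a b d d) p q.
Proof.
move=> C1 C2 x12.
have [v /[!inE] Cv vmin] := @compact_EVT_min _ R fst (cell a b d d)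
  (ex_intro _ _ C1) (@compact_cell a b d d) (continuous_subspaceT (fun p => cvg_fst)).
have Ev x : cell a b d d (x, d) -> 1 * v.1 <= 1 * x.
  by move=> Cx; rewrite !mul1r; apply: (vmin (x, d)); rewrite inE.
exists v; have [x1v|/eqP x1v] := eqVneq x1 v.1.
  apply: (has_ends_horizontal_cell Cv C2 _ Ev) (oner_neq0 _).
  by move=> x2v; apply: x12; rewrite x1v.
exact: (has_ends_horizontal_cell Cv C1 x1v Ev) (oner_neq0 _).
Qed.

End Cells.

(** * Tessellations with connected edges on each line *)

(** If the edges on each line have a connected union, they are together the only
    maximal aligned and contiguous family of this line. *)
Section OneSegmentPerLine.
Context {R : realType} (T : set (set (plane R))).

Definition edges_on (l : set (plane R)) : set (set (plane R)) :=
  [set e | inner_edges T e /\ e `<=` l].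

Hypothesis edges_connected : forall l, is_line l -> edges_on l !=set0 ->
  connected (\bigcup_(e in edges_on l) e).

Lemma edges_on_contiguous l : is_line l -> edges_on l !=set0 ->
  aligned_contiguous T (edges_on l).
Proof.
move=> ll e0; split => //.
- by move=> e [].
- by exists l => // e [].
- exact: edges_connected.
Qed.

Lemma segment_on_line l s : is_line l -> is_segment T s -> s `<=` l ->
  edges_on l !=set0 /\ s = \bigcup_(e in edges_on l) e.
Proof.
move=> ll [F [cF -> Fmax]] sl.
have FE : F `<=` edges_on l.
  move=> e Fe; split; first by case: cF => + _ _ _; exact.
  by apply: subset_trans sl; exact: bigcup_sup.
have E0 : edges_on l !=set0 by case: cF => _ [e Fe] _ _; exists e; exact: FE.
by split=> //; rewrite (Fmax _ (edges_on_contiguous ll E0) FE).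
Qed.

Lemma aligned_segments_eq s1 s2 : is_segment T s1 -> is_segment T s2 ->
  aligned s1 s2 -> s1 = s2.
Proof.
move=> S1 S2 [l [ll s1l s2l]].
by rewrite (segment_on_line ll S1 s1l).2 (segment_on_line ll S2 s2l).2.
Qed.

Lemma supporting_linesE :
  supporting_lines T = [set l | is_line l /\ edges_on l !=set0].
Proof.
apply/seteqP; split=> [l [ll [s S sl]]|l [ll E0]].
  by split=> //; exact: (segment_on_line ll S sl).1.
split=> //; exists (\bigcup_(e in edges_on l) e); last by move=> p [e [_]]; exact.
exists (edges_on l); split=> //; first exact: edges_on_contiguous.
move=> F' [F'I _ [l' ll' F'l'] _] sub.
apply/seteqP; split=> // e F'e; split; first exact: F'I.
have [e1 E1] := E0; have [[[p [q he1]] _] e1l] := E1.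
have pe1 := has_ends_left he1; have qe1 := has_ends_right he1.
have e1l' := F'l' _ (sub _ E1).
have -> : l = l'.
  by apply: (line_unique (p := p) (q := q)) => //; [case: he1|exact: e1l|exact: e1l|
     exact: e1l'|exact: e1l'].
exact: F'l'.
Qed.

End OneSegmentPerLine.

(** * Cells and edges of a layout *)

(** [rows] contains the ordinates of the horizontal lines and [cuts c] the
    abscissae of the vertical pieces crossing the strip whose lower side has
    ordinate [c]. The sentinels [lo] and [hi], strictly outside [W], belong to all
    these lists and stand for absent sides. All other values lie strictly inside
    the core, the open rectangle bounded by [xl], [xr], [yl] and [yr]. By
    [cuts_inj] a vertical line is cut in one strip only. *)
Record layout (R : realType) (W : set (plane R)) := Layout {
  lo : R; hi : R; xl : R; xr : R; yl : R; yr : R;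
  rows : seq R;
  cuts : R -> seq R;
  in_frame : forall p, W p -> lo < p.1 < hi /\ lo < p.2 < hi;
  core_sub : forall x y, xl < x < xr -> yl < y < yr -> (W° (x, y));
  core_x : [/\ lo < xl, xl < xr & xr < hi];
  core_y : [/\ lo < yl, yl < yr & yr < hi];
  lo_rows : lo \in rows;
  hi_rows : hi \in rows;
  lo_cuts : forall c, lo \in cuts c;
  hi_cuts : forall c, hi \in cuts c;
  rows_core : forall y, y \in rows -> [|| y == lo, y == hi | yl < y < yr];
  cuts_core : forall c x, x \in cuts c -> [|| x == lo, x == hi | xl < x < xr];
  cuts_inj : forall c c' x, c \in rows -> c' \in rows ->
    x \in cuts c -> x \in cuts c' -> lo < x < hi -> c = c'
}.

(** Two values of a layout, sentinels included, are separated by points of the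
    core; two such points are given, so as to show that edges are not reduced to
    a point. *)
Lemma core_meet (R : realType) (l h u v a b : R) :
  [/\ l < u, u < v & v < h] ->
  [|| a == l, a == h | u < a < v] -> [|| b == l, b == h | u < b < v] -> a < b ->
  exists t1 t2, [/\ a < t1, t1 < t2, t2 < b, u < t1 & t2 < v].
Proof.
move=> [lu uv vh] ha hb ab.
have av : a < v by case/or3P: ha => [/eqP|/eqP|]; case/or3P: hb => [/eqP|/eqP|]; lra.
have ub : u < b by case/or3P: ha => [/eqP|/eqP|]; case/or3P: hb => [/eqP|/eqP|]; lra.
pose s := Num.max a u; pose t := Num.min b v.
have st : s < t by rewrite /s /t gt_max !lt_min ab av ub uv.
have [sa su] : a <= s /\ u <= s by rewrite /s !le_max !lexx orbT.
have [tb tv] : t <= b /\ t <= v by rewrite /t !ge_min !lexx orbT.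
by exists (s + (t - s) / 3), (s + (t - s) / 2); split; lra.
Qed.

Section Tessellation.
Context {R : realType} (W : set (plane R)).
Hypotheses (W_compact : compact W) (W_convex : convex_set W).
Variable L : layout W.

Local Notation cell := (cell W).
Local Notation rows := (rows L).
Local Notation cuts := (cuts L).
Local Notation lo := (lo L).
Local Notation hi := (hi L).
Local Notation xl := (xl L).
Local Notation xr := (xr L).
Local Notation yl := (yl L).
Local Notation yr := (yr L).

Definition tessellation : set (set (plane R)) :=
  [set C | exists a b c d,
    [/\ consecutive rows c d, consecutive (cuts c) a b & C = cell a b c d]].

Definition vertical_edge (e : set (plane R)) := exists a c d,
  [/\ consecutive rows c d, a \in cuts c, lo < a < hi & e = cell a a c d].

(** Below the line of ordinate [d] the strip is cut at [cuts c], above it at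
    [cuts d]: both kinds of cuts abut on the line and split it into edges. *)
Definition horizontal_edge (e : set (plane R)) := exists a b c d d',
  [/\ consecutive rows c d, consecutive rows d d',
      consecutive (cuts c ++ cuts d) a b & e = cell a b d d].

Lemma rows_range y : y \in rows -> lo <= y <= hi.
Proof.
by have [? ? ?] := core_y L; move=> /rows_core/or3P[/eqP->|/eqP->|]; lra.
Qed.

Lemma cuts_range c x : x \in cuts c -> lo <= x <= hi.
Proof.
by have [? ? ?] := core_x L; move=> /cuts_core/or3P[/eqP->|/eqP->|]; lra.
Qed.

Lemma rows_inner y : y \in rows -> lo < y < hi -> yl < y < yr.
Proof. by move=> /rows_core/or3P[/eqP->|/eqP->|]; lra. Qed.

Lemma cuts_inner c x : x \in cuts c -> lo < x < hi -> xl < x < xr.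
Proof. by move=> /cuts_core/or3P[/eqP->|/eqP->|]; lra. Qed.

Lemma rows_between c d d' : consecutive rows c d -> consecutive rows d d' ->
  lo < d < hi.
Proof. by move=> [/rows_range + _ + _] [_ /rows_range + + _]; lra. Qed.

Lemma cell_sub a b c d : cell a b c d `<=` W.
Proof. by move=> p []. Qed.

Lemma core_cell a b c d x y : xl < x < xr -> yl < y < yr ->
  a <= x <= b -> c <= y <= d -> cell a b c d (x, y).
Proof.
by move=> hx hy ax cy; split=> //; exact: (interior_subset (core_sub hx hy)).
Qed.

Lemma strip_meets_core c d : consecutive rows c d ->
  exists y1 y2, [/\ c < y1, y1 < y2, y2 < d, yl < y1 & y2 < yr].
Proof.
move=> [/rows_core c0 /rows_core d0 cd _].
exact: core_meet (core_y L) c0 d0 cd.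
Qed.

Lemma column_meets_core X c c' a b : {subset X <= cuts c ++ cuts c'} ->
  consecutive X a b ->
  exists x1 x2, [/\ a < x1, x1 < x2, x2 < b, xl < x1 & x2 < xr].
Proof.
have core x : x \in cuts c ++ cuts c' -> [|| x == lo, x == hi | xl < x < xr].
  by rewrite mem_cat => /orP[] /cuts_core.
move=> XS [/XS/core a0 /XS/core b0 ab _].
exact: core_meet (core_x L) a0 b0 ab.
Qed.

Lemma interior_tess a b c d : consecutive rows c d -> consecutive (cuts c) a b ->
  exists p, (cell a b c d)° p.
Proof.
move=> cd ab.
have [y1 [y2 [? ? ? ? ?]]] := strip_meets_core cd.
have [|x1 [x2 [? ? ? ? ?]]] := @column_meets_core _ c c _ _ _ ab.
  by move=> x; rewrite mem_cat => ->.
exists (x1, y1); apply/interior_cell; split=> //=; try lra.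
by apply: core_sub; lra.
Qed.

(** The interior of a cell meets no other cell. This gives the disjointness of the
    interiors, and also that cells with different bounds are different sets. *)
Lemma tess_unique a b c d a' b' c' d' p :
  consecutive rows c d -> consecutive (cuts c) a b ->
  consecutive rows c' d' -> consecutive (cuts c') a' b' ->
  (cell a b c d)° p -> cell a' b' c' d' p ->
  [/\ a' = a, b' = b, c' = c & d' = d].
Proof.
move=> cd ab cd' ab' /interior_cell[_ px py] [_ /= [px' py']].
have [c'E d'E] := consecutive_overlap cd cd' py py'.
rewrite c'E in ab'.
by have [-> ->] := consecutive_overlap ab ab' px px'.
Qed.

Lemma finite_tess : finite_set tessellation.
Proof.
pose xs := flatten (map cuts rows).
pose S := (([set` xs] `*` [set` xs]) `*` ([set` rows] `*` [set` rows])).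
pose f (t : (R * R) * (R * R)) := cell t.1.1 t.1.2 t.2.1 t.2.2.
apply: (@sub_finite_set _ _ (f @` S)); last first.
  by apply: finite_image; do 2?apply: finite_setX; exact: finite_seq.
move=> _ [a [b [c [d [[cR dR _ _] [aX bX _ _] ->]]]]].
have inxs x : x \in cuts c -> x \in xs.
  by move=> xX; apply/flattenP; exists (cuts c) => //; exact: map_f.
by exists ((a, b), (c, d)) => //; split; split => //=; exact: inxs.
Qed.

Lemma finite_inner_edges : finite_set (inner_edges tessellation).
Proof.
pose f (t : set (plane R) * set (plane R)) := t.1 `&` t.2.
apply: (@sub_finite_set _ _ (f @` (tessellation `*` tessellation))).
  by move=> e [_ [c [d [Tc Td _ ->]]]]; exists (c, d).
by apply: finite_image; apply: finite_setX; exact: finite_tess.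
Qed.

Lemma tess_cover : \bigcup_(c in tessellation) c = W.
Proof.
apply/seteqP; split=> [p [_ [a [b [c [d [_ _ ->]]]]]]|p Wp]; first exact: cell_sub.
have [/andP[x1 x2] /andP[y1 y2]] := in_frame L Wp.
have [c [d [cd cyd]]] := consecutive_from (lo_rows L) (hi_rows L) (ltW y1) y2.
have [a [b [ab axb]]] := consecutive_from (lo_cuts L c) (hi_cuts L c) (ltW x1) x2.
exists (cell a b c d); first by exists a, b, c, d.
by split=> //; split; lra.
Qed.

Lemma trivIset_tess : trivIset tessellation (fun c => c°).
Proof.
move=> _ _ [a [b [c [d [cd ab ->]]]]] [a' [b' [c' [d' [cd' ab' ->]]]]].
move=> [p [p1 p2]].
by have [-> -> -> ->] := tess_unique cd ab cd' ab' p1 (interior_subset p2).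
Qed.

Lemma cell_neq a b c d a' b' c' d' :
  consecutive rows c d -> consecutive (cuts c) a b ->
  consecutive rows c' d' -> consecutive (cuts c') a' b' ->
  a <> a' \/ c <> c' -> cell a b c d <> cell a' b' c' d'.
Proof.
move=> cd ab cd' ab' ne E.
have [p pI] := interior_tess cd ab.
have [|a'E _ c'E _] := tess_unique (p := p) cd ab cd' ab' pI.
  by rewrite -E; exact: interior_subset.
by case: ne; apply.
Qed.

Lemma vertical_edge_points a c d : consecutive rows c d -> a \in cuts c -> lo < a < hi ->
  exists y1 y2, [/\ c < y1, y1 < y2, y2 < d,
    cell a a c d (a, y1) & cell a a c d (a, y2)].
Proof.
move=> cd ac ai; have axr := cuts_inner ac ai.
have [y1 [y2 [? ? ? ? ?]]] := strip_meets_core cd.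
by exists y1, y2; split=> //; apply: core_cell => //; lra.
Qed.

Lemma horizontal_edge_points a b c d d' : consecutive rows c d -> consecutive rows d d' ->
  consecutive (cuts c ++ cuts d) a b ->
  exists x1 x2, [/\ a < x1, x1 < x2, x2 < b,
    cell a b d d (x1, d) & cell a b d d (x2, d)].
Proof.
move=> cd dd' ab.
have dyr : yl < d < yr.
  by apply: rows_inner; [case: cd|exact: rows_between cd dd'].
have [//|x1 [x2 [? ? ? ? ?]]] := @column_meets_core _ c d _ _ _ ab.
by exists x1, x2; split=> //; apply: core_cell => //; lra.
Qed.

(** The two cells are those on both sides of the cut. *)
Lemma inner_edges_vertical_edge e : vertical_edge e -> inner_edges tessellation e.
Proof.
move=> [x [c [d [cd xc xi ->]]]]; split.
  have [y1 [y2 [_ y12 _ C1 C2]]] := vertical_edge_points cd xc xi.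
  by apply: (vertical_cell_has_ends W_compact W_convex C1 C2); lra.
have [lx xh] := andP xi.
have [a ax] := consecutive_pred xc (lo_cuts L c) lx.
have [b xb] := consecutive_succ xc (hi_cuts L c) xh.
have [[_ _ ltax _] [_ _ ltxb _]] := (ax, xb).
exists (cell a x c d), (cell x b c d); split.
- by exists a, x, c, d.
- by exists x, b, c, d.
- by apply: cell_neq => //; left; lra.
- by rewrite cellI !maxxx !minxx max_r ?min_l //; lra.
Qed.

(** The two cells are those of the lower and of the upper strip whose horizontal
    sides contain the edge. *)
Lemma inner_edges_horizontal_edge e : horizontal_edge e -> inner_edges tessellation e.
Proof.
move=> [a [b [c [d [d' [cd dd' ab ->]]]]]]; split.
  have [x1 [x2 [_ x12 _ C1 C2]]] := horizontal_edge_points cd dd' ab.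
  by apply: (horizontal_cell_has_ends W_compact W_convex C1 C2); lra.
have [aX bX ltab _] := ab.
have range x : x \in cuts c ++ cuts d -> lo <= x <= hi.
  by rewrite mem_cat => /orP[] /cuts_range.
have [/andP[loa _] /andP[_ bhi]] := (range _ aX, range _ bX).
have [a1 [b1 [ab1 a1a bb1]]] : exists a' b',
    [/\ consecutive (cuts c) a' b', a' <= a & b <= b'].
  apply: (consecutive_sub _ ab (lo_cuts L c) (hi_cuts L c)) => //.
  by move=> x; rewrite mem_cat => ->.
have [a2 [b2 [ab2 a2a bb2]]] : exists a' b',
    [/\ consecutive (cuts d) a' b', a' <= a & b <= b'].
  apply: (consecutive_sub _ ab (lo_cuts L d) (hi_cuts L d)) => //.
  by move=> x; rewrite mem_cat orbC => ->.
have [maxE minE] := consecutive_cat_meet ab ab1 ab2 a1a bb1 a2a bb2.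
have [_ _ ltcd _] := cd; have [_ _ ltdd' _] := dd'.
exists (cell a1 b1 c d), (cell a2 b2 d d'); split.
- by exists a1, b1, c, d.
- by exists a2, b2, d, d'.
- by apply: cell_neq => //; right; lra.
- by rewrite cellI maxE minE max_r ?min_l //; lra.
Qed.

(** Two cells of a strip meet in a common cut, or not at all; two cells of
    different strips meet only if the strips are adjacent, and then along an
    elementary interval of the line between them, or in a single point, which
    is not an edge. *)
Lemma inner_edgesP e : inner_edges tessellation e <-> vertical_edge e \/ horizontal_edge e.
Proof.
split; last by case; [exact: inner_edges_vertical_edge|exact: inner_edges_horizontal_edge].
move=> [[p [q pqe]] [_ [_ [[a [b [c [d [cd ab ->]]]]]
  [a' [b' [c' [d' [cd' ab' ->]]]]] ne eE]]]].
(* by symmetry, the first cell lies on the left of the second one, or below *)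
wlog : a b c d a' b' c' d' cd ab cd' ab' ne eE /
    (c = c' /\ d = d' /\ b <= a') \/ d <= c' => [H|].
  case: (consecutive_disjoint cd cd') => [[cE dE]|[dc|dc]].
  - rewrite -cE in ab'.
    case: (consecutive_disjoint ab ab') => [[aE bE]|[ba|ba]].
    + by exfalso; apply: ne; rewrite aE bE cE dE.
    + by apply: (H a b c d a' b' c' d') => //; [rewrite -cE|left].
    + apply: (H a' b' c' d' a b c d) => //; [by rewrite -cE| | |by left].
        by move=> /esym.
      by rewrite setIC.
  - by apply: (H a b c d a' b' c' d') => //; right.
  - apply: (H a' b' c' d' a b c d) => //; [| |by right].
      by move=> /esym.
    by rewrite setIC.
have ep : e p by exact: has_ends_left pqe.
have eq : e q by exact: has_ends_right pqe.
have pq : p <> q by case: pqe.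
have We r : e r -> W r by rewrite eE => -[[]].
have [/andP[xp1 xp2] /andP[yp1 yp2]] := in_frame L (We _ ep).
move: ep eq; rewrite eE => -[[_ /= [p1 p2]] [_ /= [p1' p2']]].
move=> [[_ /= [q1 q2]] [_ /= [q1' q2']]].
case=> [[cE [dE ba']]|dc'].
  have a'E : a' = b by lra.
  left; exists b, c, d; split=> //; first by case: ab.
    by lra.
  have [_ _ ltab _] := ab; have [_ _ ltab' _] := ab'.
  by rewrite -cE -dE a'E cellI !maxxx !minxx max_r ?min_l //; lra.
have c'E : c' = d by lra.
rewrite c'E in cd' ab' *.
right; exists (Num.max a a'), (Num.min b b'), c, d, d'; split=> //.
  apply: consecutive_cat => //; rewrite ltNge; apply/negP => m.
  have mp : Num.max a a' <= p.1 <= Num.min b b' by rewrite ge_max le_min; lra.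
  have mq : Num.max a a' <= q.1 <= Num.min b b' by rewrite ge_max le_min; lra.
  apply: pq; rewrite [p]surjective_pairing [q]surjective_pairing.
  by congr pair; lra.
have [_ _ ltcd _] := cd; have [_ _ ltdd' _] := cd'.
by rewrite cellI (max_r (ltW ltcd)) (min_l (ltW ltdd')).
Qed.

(** * The cells form a polygonal tessellation *)

Lemma boundary_cell a b c d p : boundary (cell a b c d) p <->
  cell a b c d p /\ ~ (W° p /\ a < p.1 < b /\ c < p.2 < d).
Proof.
rewrite /boundary -(closure_id _).1; last exact: closed_cell.
split=> -[Cp nI]; split=> //.
  by move=> [Wp [px py]]; apply: nI; apply/interior_cell.
by move=> /interior_cell[Wp px py]; apply: nI.
Qed.

Lemma sub_boundary_cell e a b c d : e `<=` cell a b c d ->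
  (forall q, e q -> ~ (a < q.1 < b /\ c < q.2 < d)) ->
  e `<=` boundary (cell a b c d).
Proof.
move=> eC eb q eq; apply/boundary_cell; split; first exact: eC.
by move=> [_]; exact: eb.
Qed.

Lemma horizontal_edge_through c d d' a b x : consecutive rows c d -> consecutive rows d d' ->
  a \in cuts c ++ cuts d -> b \in cuts c ++ cuts d -> a <= x < b ->
  exists a' b', [/\ horizontal_edge (cell a' b' d d), a <= a', b' <= b & a' <= x < b'].
Proof.
move=> cd dd' aX bX /andP[ax xb].
have [a' [b' [ab' /andP[a'x xb']]]] := consecutive_from aX bX ax xb.
have [_ _ _ h] := ab'.
exists a', b'; split; first by exists a', b', c, d, d'.
- by have := h _ aX; lra.
- by have := h _ bX; lra.
- by rewrite a'x xb'.
Qed.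

(** A boundary point of a cell which is interior to [W] lies on a side of the
    rectangle, and that side is not a sentinel. A vertical side is an edge; a
    horizontal one is a union of edges, since the sides of a cell are also
    values of the finer subdivision of the line. *)
Lemma boundary_cell_edge a b c d p :
  consecutive rows c d -> consecutive (cuts c) a b ->
  boundary (cell a b c d) p -> W° p ->
  exists e, [/\ inner_edges tessellation e, e `<=` boundary (cell a b c d) & e p].
Proof.
move=> cd ab /boundary_cell[[Wp [/= px py]] nI] Ip.
have [/andP[lx xh] /andP[ly yh]] := in_frame L Wp.
have [aX bX ltab _] := ab; have [cX dX ltcd _] := cd.
have side x : x \in cuts c -> a <= x <= b -> (x = a \/ x = b) -> p.1 = x ->
    exists e, [/\ inner_edges tessellation e, e `<=` boundary (cell a b c d) & e p].
  move=> xc axb xab pE; exists (cell x x c d); split.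
  - by apply/inner_edgesP; left; exists x, c, d; split => //; lra.
  - apply: sub_boundary_cell => [q [Wq [/= qx qy]]|q [Wq [/= qx qy]] [h _]].
      by split=> //; split => //=; lra.
    by case: xab => xE; lra.
  - by split=> //; split=> //=; lra.
have [pa|npa] := eqVneq (p.1 : R) a; first by apply: (side a) => //; [lra|left].
have [pb|npb] := eqVneq (p.1 : R) b; first by apply: (side b) => //; [lra|right].
have {}px : a < p.1 < b by rewrite !lt_neqAle eq_sym npa npb.
have [pc|npc] := eqVneq (p.2 : R) c.
  have [c0 c0c] := consecutive_pred cX (lo_rows L) (ltac:(lra)).
  have [|||a' [b' [he aa' bb' xab']]] := @horizontal_edge_through c0 c d a b p.1 c0c cd.
  - by rewrite mem_cat aX orbT.
  - by rewrite mem_cat bX orbT.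
  - by lra.
  exists (cell a' b' c c); split.
  - by apply/inner_edgesP; right.
  - apply: sub_boundary_cell => [q [Wq [/= qx qy]]|q [Wq [/= qx qy]] [_ h]].
      by split=> //; split => //=; lra.
    by lra.
  - by split=> //; split=> //=; lra.
have [pd|npd] := eqVneq (p.2 : R) d.
  have [d' dd'] := consecutive_succ dX (hi_rows L) (ltac:(lra)).
  have [|||a' [b' [he aa' bb' xab']]] := @horizontal_edge_through c d d' a b p.1 cd dd'.
  - by rewrite mem_cat aX.
  - by rewrite mem_cat bX.
  - by lra.
  exists (cell a' b' d d); split.
  - by apply/inner_edgesP; right.
  - apply: sub_boundary_cell => [q [Wq [/= qx qy]]|q [Wq [/= qx qy]] [_ h]].
      by split=> //; split => //=; lra.
    by lra.
  - by split=> //; split=> //=; lra.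
exfalso; apply: nI; split=> //; split=> //.
by rewrite !lt_neqAle eq_sym npc npd.
Qed.

Lemma polygonal_tess : polygonal_tessellation W tessellation.
Proof.
split.
- exact: finite_tess.
- exact: tess_cover.
- move=> _ [a [b [c [d [cd ab ->]]]]]; split; first exact: closed_cell.
    exact: convex_cell.
  by have [p] := interior_tess cd ab; exists p.
- exact: trivIset_tess.
move=> _ [a [b [c [d [cd ab ->]]]]].
set C := cell a b c d.
exists [set e | inner_edges tessellation e /\ e `<=` boundary C],
  (boundary C `&` boundary W); split.
- by apply: sub_finite_set (finite_inner_edges) => e [].
- by move=> e [].
- by move=> p [].
apply/seteqP; split=> [p pb|p [[e [_ eC] /eC]|[]]//].
have [bW|nbW] := pselect (boundary W p); first by right.
left; have Ip : W° p.
  apply: contrapT => nIp; apply: nbW; split=> //; apply: subset_closure.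
  by case: ((boundary_cell _ _ _ _ _).1 pb) => -[].
by have [e [eI eC ep]] := boundary_cell_edge cd ab pb Ip; exists e.
Qed.

(** * Vertices are T-shaped *)

Lemma card_set3 (T : Type) (x y z : T) : x <> y -> x <> z -> y <> z ->
  ([set x; y; z] #= `I_3)%card.
Proof.
move=> xy xz yz; apply/eq_cardSP; exists x; first by left; left.
apply/eq_cardSP; exists y; first by split; [left; right|move=> /esym].
suff -> : ([set x; y; z] `\ x) `\ y = [set z] by exact: card_set1.
apply/seteqP; split=> [t [[[[]|]]]//|_ ->].
by split; [split; [right|move=> /esym]|move=> /esym].
Qed.

Lemma inner_edge_sub e : inner_edges tessellation e -> e `<=` W.
Proof.
move=> [_ [_ [_ [[a [b [c [d [_ _ ->]]]]] _ _ ->]]]] p [+ _].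
exact: cell_sub.
Qed.

(** The crossings of the lines lie in the core, so that no two edges meet on the
    boundary of [W]. *)
Lemma core_vertex x y : x \in flatten (map cuts rows) -> y \in rows ->
  lo < x < hi -> lo < y < hi -> W° (x, y).
Proof.
move=> /flatten_mapP[c _ xc] yr xi yi.
by apply: core_sub; [exact: cuts_inner xc xi|exact: rows_inner].
Qed.

Lemma vertical_edge_boundary a c d v : consecutive rows c d -> a \in cuts c ->
  cell a a c d v -> ~ W° v -> v.1 = a /\ c < v.2 < d.
Proof.
move=> cd ac [Wv [/= vx vy]] nI; have vE : v.1 = a by lra.
split=> //; have [cR dR ltcd _] := cd.
have [v1 v2] := in_frame L Wv.
have N y : y \in rows -> v.2 <> y.
  move=> yR yE; apply: nI; rewrite [v]surjective_pairing vE yE.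
  apply: core_vertex => //; [|by rewrite -vE|by rewrite -yE].
  by apply/flatten_mapP; exists c.
by rewrite !lt_neqAle eq_sym; case/andP: vy => -> ->; rewrite !andbT;
   apply/andP; split; apply/eqP; exact: N.
Qed.

Lemma horizontal_edge_boundary a b c d d' v : consecutive rows c d -> consecutive rows d d' ->
  consecutive (cuts c ++ cuts d) a b ->
  cell a b d d v -> ~ W° v -> v.2 = d /\ a < v.1 < b.
Proof.
move=> cd dd' ab [Wv [/= vx vy]] nI; have vE : v.2 = d by lra.
split=> //; have [aX bX ltab _] := ab.
have [cR dR _ _] := cd.
have [v1 v2] := in_frame L Wv.
have N x : x \in cuts c ++ cuts d -> v.1 <> x.
  move=> xX xE; apply: nI; rewrite [v]surjective_pairing vE xE.
  apply: core_vertex => //; [|by rewrite -xE|by rewrite -vE].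
  by apply/flatten_mapP; move: xX; rewrite mem_cat => /orP[]; [exists c|exists d].
by rewrite !lt_neqAle eq_sym; case/andP: vx => -> ->; rewrite !andbT;
   apply/andP; split; apply/eqP; exact: N.
Qed.

Lemma boundary_edge_unique e e' v : inner_edges tessellation e -> inner_edges tessellation e' ->
  e v -> e' v -> ~ W° v -> e = e'.
Proof.
have VH a c d a' b' c' d' d'' : consecutive rows c d -> a \in cuts c ->
    consecutive rows c' d' -> consecutive rows d' d'' ->
    consecutive (cuts c' ++ cuts d') a' b' ->
    cell a a c d v -> cell a' b' d' d' v -> ~ W° v -> False.
  move=> cd ac cd' dd'' ab' Cv Cv' nI.
  have [_ vcd] := vertical_edge_boundary cd ac Cv nI.
  have [vd' _] := horizontal_edge_boundary cd' dd'' ab' Cv' nI.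
  by have [_ _ _ /(_ d')] := cd; case: cd' => _ -> _ _ /(_ isT); lra.
move=> /inner_edgesP[[a [c [d [cd ac ai ->]]]]|[a [b [c [d [d1 [cd dd1 ab ->]]]]]]]
       /inner_edgesP[[a' [c' [d' [cd' ac' ai' ->]]]]|
                     [a' [b' [c' [d' [d1' [cd' dd1' ab' ->]]]]]]] Cv Cv' nI.
- have [va vcd] := vertical_edge_boundary cd ac Cv nI.
  have [va' vcd'] := vertical_edge_boundary cd' ac' Cv' nI.
  have [|-> ->] := consecutive_overlap cd cd' vcd; first by lra.
  by rewrite -va -va'.
- by exfalso; exact: (VH a c d a' b' c' d' d1').
- by exfalso; exact: (VH a' c' d' a b c d d1).
- have [vd vab] := horizontal_edge_boundary cd dd1 ab Cv nI.
  have [vd' vab'] := horizontal_edge_boundary cd' dd1' ab' Cv' nI.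
  have dE : d' = d by rewrite -vd -vd'.
  rewrite dE in cd' ab' *.
  rewrite (consecutive_right cd cd') in ab'.
  by have [|-> ->] := consecutive_overlap ab ab' vab; first by lra.
Qed.

(** Inside [W], an edge extends around each of its points which is not on a side
    of its rectangle, so that its ends are crossings of lines. *)
Lemma interior_vertex e v q : inner_edges tessellation e -> has_ends e v q -> W° v ->
  exists c d d', [/\ consecutive rows c d, consecutive rows d d',
    v.1 \in cuts c ++ cuts d, lo < v.1 < hi & v.2 = d].
Proof.
move=> eI he /interior_planeP[r r0 hr].
have ev := has_ends_left he.
have [v1 v2] := in_frame L (inner_edge_sub eI ev).
move: eI he ev => /inner_edgesP[[a [c [d [cd ac ai ->]]]]|
                                [a [b [c [d [d1 [cd dd1 ab ->]]]]]]] he.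
  move=> [_ [/= va vcd]]; have {va}va : v.1 = a by lra.
  have [cR dR ltcd _] := cd.
  have [vc|/eqP nvc] := eqVneq (v.2 : R) c.
    have [c0 c0c] := consecutive_pred cR (lo_rows L) (ltac:(lra)).
    by exists c0, c, d; split=> //; rewrite mem_cat va ac orbT.
  have [vd|/eqP nvd] := eqVneq (v.2 : R) d.
    have [d' dd'] := consecutive_succ dR (hi_rows L) (ltac:(lra)).
    by exists c, d, d'; split=> //; rewrite mem_cat va ac.
  exfalso.
  pose w := Num.min (r / 2) (Num.min (v.2 - c) (d - v.2)).
  have w0 : 0 < w by rewrite !lt_min; lra.
  have [wr [wc wd]] : w <= r / 2 /\ w <= v.2 - c /\ w <= d - v.2.
    by rewrite /w !ge_min !lexx ?orbT.
  have P s : - w <= s <= w -> cell a a c d (v.1 + 0, v.2 + s).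
    move=> sw; split; last by split=> /=; lra.
    by apply: hr => /=; rewrite addrAC subrr add0r ?normr0// ltr_norml; lra.
  have [||_ wE] := has_ends_extreme (w1 := 0) (w2 := w) he.
  - by apply: P; lra.
  - by rewrite oppr0; apply: P; lra.
  by move: w0; rewrite wE ltxx.
move=> [_ [/= vab vd]]; have {vd}vd : v.2 = d by lra.
exists c, d, d1; split=> //; have [aX bX ltab _] := ab.
have [->//|/eqP nva] := eqVneq (v.1 : R) a.
have [->//|/eqP nvb] := eqVneq (v.1 : R) b.
exfalso.
pose w := Num.min (r / 2) (Num.min (v.1 - a) (b - v.1)).
have w0 : 0 < w by rewrite !lt_min; lra.
have [wr [wa wb]] : w <= r / 2 /\ w <= v.1 - a /\ w <= b - v.1.
  by rewrite /w !ge_min !lexx ?orbT.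
have P s : - w <= s <= w -> cell a b d d (v.1 + s, v.2 + 0).
  move=> sw; split; last by split=> /=; lra.
  by apply: hr => /=; rewrite addrAC subrr add0r ?normr0// ltr_norml; lra.
have [||wE _] := has_ends_extreme (w1 := w) (w2 := 0) he.
- by apply: P; lra.
- by rewrite oppr0; apply: P; lra.
by move: w0; rewrite wE ltxx.
Qed.

(** The foot [(z, d)] of a cut on a horizontal line. The strip [s] of the cut is
    the one below or the one above the line; by [cuts_inj] the vertical line is
    not cut in the other one, hence there is no fourth edge. *)
Lemma incident_grid c d d' z s t a b :
  consecutive rows c d -> consecutive rows d d' -> lo < z < hi ->
  z \in cuts s -> (s = c /\ t = d) \/ (s = d /\ t = d') ->
  consecutive (cuts c ++ cuts d) a z -> consecutive (cuts c ++ cuts d) z b ->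
  incident_edges tessellation (z, d) =
    [set cell a z d d; cell z b d d; cell z z s t].
Proof.
move=> cd dd' zi zs st az zb.
have stc : consecutive rows s t by case: st => -[-> ->].
have [_ _ ltcd _] := cd; have [_ _ ltdd' _] := dd'.
have [_ zX ltaz _] := az; have [_ _ ltzb _] := zb.
have Gz : W (z, d).
  apply: interior_subset; apply: core_sub; first exact: cuts_inner zs zi.
  by apply: rows_inner; [case: cd|exact: rows_between cd dd'].
apply/seteqP; split=> [e [/inner_edgesP eI [q he]]|e eE].
  have ev := has_ends_left he.
  move: eI ev => [[a' [c' [d1 [cd' ac' ai ->]]]]|
                  [a' [b' [c1 [d1 [d2 [cd' dd2 ab' ->]]]]]]] [_ [/= zab dd]].
    right; have a'E : a' = z by lra.
    rewrite a'E in ac' *.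
    have c'E : c' = s.
      by case: cd' stc => cR' _ _ _ [sR _ _ _]; exact: cuts_inj cR' sR ac' zs zi.
    by rewrite c'E in cd' *; rewrite (consecutive_left stc cd').
  left; have d1E : d1 = d by lra.
  rewrite d1E in cd' dd2 ab' *.
  rewrite (consecutive_right cd cd') in ab'.
  have [zE|zE] := consecutive_mem ab' zX zab; rewrite -zE in ab' *.
    by right; rewrite (consecutive_left zb ab').
  by left; rewrite (consecutive_right az ab').
move: eE => [[->|->]|->]; split.
- by apply/inner_edgesP; right; exists a, z, c, d, d'.
- have [x1 [x2 [? ? ? C1 C2]]] := horizontal_edge_points cd dd' az.
  apply: (has_ends_horizontal_cell W_compact W_convex (x := x1) (x' := -1)) => //=.
  + by split=> //; split=> /=; lra.
  + by lra.
  + by move=> x [_ [/= ]]; lra.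
- by apply/inner_edgesP; right; exists z, b, c, d, d'.
- have [x1 [x2 [? ? ? C1 C2]]] := horizontal_edge_points cd dd' zb.
  apply: (has_ends_horizontal_cell W_compact W_convex (x := x1) (x' := 1)) => //=.
  + by split=> //; split=> /=; lra.
  + by lra.
  + by move=> x [_ [/= ]]; lra.
- by apply/inner_edgesP; left; exists z, s, t.
- have [y1 [y2 [? ? ? C1 C2]]] := vertical_edge_points stc zs zi.
  case: st => -[sE tE]; rewrite sE tE in C1 *.
  + apply: (has_ends_vertical_cell W_compact W_convex (y := y1) (y' := -1)) => //=.
    * by split=> //; split=> /=; lra.
    * by lra.
    * by move=> y [_ [/= ]]; lra.
  + apply: (has_ends_vertical_cell W_compact W_convex (y := y1) (y' := 1)) => //=.
    * by split=> //; split=> /=; lra.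
    * by lra.
    * by move=> y [_ [/= ]]; lra.
Qed.

Lemma T_shaped_tess v : is_vertex tessellation v -> T_shaped W tessellation v.
Proof.
move=> [e [eI [q he]]].
have Wv := inner_edge_sub eI (has_ends_left he).
have [Iv|nIv] := pselect (W° v); last first.
  right; split; last by split=> //; exact: subset_closure.
  suff -> : incident_edges tessellation v = [set e] by exact: card_set1.
  apply/seteqP; split=> [e' [eI' [q' he']]|_ ->]; last by split=> //; exists q.
  exact: (boundary_edge_unique eI' eI (has_ends_left he') (has_ends_left he)).
left; have [c [d [d' [cd dd' zX zi vd]]]] := interior_vertex eI he Iv.
have vE : v = (v.1, d) by rewrite -vd -surjective_pairing.
move: (v.1) zX zi vE => z zX zi -> {v e eI q he Wv Iv vd}.
have [lz zh] := andP zi.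
have loX : lo \in cuts c ++ cuts d by rewrite mem_cat lo_cuts.
have hiX : hi \in cuts c ++ cuts d by rewrite mem_cat hi_cuts.
have [a az] := consecutive_pred zX loX lz.
have [b zb] := consecutive_succ zX hiX zh.
have [s [t [zs st]]] : exists s t, z \in cuts s /\
    ((s = c /\ t = d) \/ (s = d /\ t = d')).
  move: zX; rewrite mem_cat => /orP[zc|zd].
    by exists c, d; split=> //; left.
  by exists d, d'; split=> //; right.
have IE := incident_grid cd dd' zi zs st az zb.
have [x1 [x2 [? ? ? C1 C2]]] := horizontal_edge_points cd dd' az.
have [x3 [x4 [? ? ? C3 C4]]] := horizontal_edge_points cd dd' zb.
have neq : cell a z d d <> cell z b d d.
  by move=> E; move: C1; rewrite E => -[_ [/= ]]; lra.
split.
  rewrite IE; apply: card_set3 => //.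
    by move=> E; move: C1; rewrite E => -[_ [/= ]]; lra.
  by move=> E; move: C4; rewrite E => -[_ [/= ]]; lra.
exists (cell a z d d), (cell z b d d); rewrite IE; split=> //.
- by left; left.
- by left; right.
exists (horizontal_line d); split; first exact: is_line_horizontal.
- by move=> p [_ [_ /=]]; rewrite /horizontal_line/=; lra.
- by move=> p [_ [_ /=]]; rewrite /horizontal_line/=; lra.
Qed.

(** * Segments and supporting lines *)

Lemma vertical_edge_line a c d l : consecutive rows c d -> a \in cuts c -> lo < a < hi ->
  is_line l -> cell a a c d `<=` l -> l = vertical_line a.
Proof.
move=> cd ac ai ll el.
have [y1 [y2 [? y12 ? C1 C2]]] := vertical_edge_points cd ac ai.
apply: (line_unique (p := (a, y1)) (q := (a, y2))) => //.
- exact: is_line_vertical.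
- by case=> y12E; lra.
- exact: el.
- exact: el.
Qed.

Lemma horizontal_edge_line a b c d d' l : consecutive rows c d -> consecutive rows d d' ->
  consecutive (cuts c ++ cuts d) a b -> is_line l -> cell a b d d `<=` l ->
  l = horizontal_line d.
Proof.
move=> cd dd' ab ll el.
have [x1 [x2 [? x12 ? C1 C2]]] := horizontal_edge_points cd dd' ab.
apply: (line_unique (p := (x1, d)) (q := (x2, d))) => //.
- exact: is_line_horizontal.
- by case=> x12E; lra.
- exact: el.
- exact: el.
Qed.

Lemma edges_on_vertical_line a c d : consecutive rows c d -> a \in cuts c ->
  lo < a < hi -> edges_on tessellation (vertical_line a) = [set cell a a c d].
Proof.
move=> cd ac ai; apply/seteqP; split=> [e [/inner_edgesP eI el]|_ ->]; last first.
  split; first by apply/inner_edgesP; left; exists a, c, d.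
  by move=> p [_ [/= ? _]]; rewrite /vertical_line/=; lra.
move: eI el => [[a' [c' [d' [cd' ac' ai' ->]]]]|
                [a' [b' [c' [d' [d2 [cd' dd2 ab' ->]]]]]]] el.
  have [y1 [y2 [_ _ _ /el/= a'E _]]] := vertical_edge_points cd' ac' ai'.
  rewrite /vertical_line/= in a'E; rewrite a'E in ac' *.
  have c'E : c' = c.
    by case: cd' cd => cR' _ _ _ [cR _ _ _]; exact: cuts_inj cR' cR ac' ac ai.
  by rewrite c'E in cd' *; rewrite (consecutive_left cd cd').
have [x1 [x2 [_ x12 _ /el x1a /el x2a]]] := horizontal_edge_points cd' dd2 ab'.
by exfalso; move: x1a x2a x12; rewrite /vertical_line/=; lra.
Qed.

(** With the sentinels as bounds, the whole chord of [W] is itself a degenerate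
    cell, hence a segment; this is why the edges have a connected union. *)
Lemma edges_on_horizontal_line c d d' : consecutive rows c d -> consecutive rows d d' ->
  \bigcup_(e in edges_on tessellation (horizontal_line d)) e = cell lo hi d d.
Proof.
move=> cd dd'; apply/seteqP; split=> [p [e [eI el] ep]|p [Wp [/= px py]]].
  have Wp := inner_edge_sub eI ep; split=> //=.
  by have := in_frame L Wp; have := el _ ep; rewrite /horizontal_line/=; lra.
have [/andP[lx xh] _] := in_frame L Wp.
have [|||a [b [he la bh xab]]] := @horizontal_edge_through c d d' lo hi p.1 cd dd'.
- by rewrite mem_cat lo_cuts.
- by rewrite mem_cat hi_cuts.
- by rewrite ltW.
exists (cell a b d d); last by split=> //; split=> //=; lra.
split; first by apply/inner_edgesP; right.
by move=> q [_ [/= _ ?]]; rewrite /horizontal_line/=; lra.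
Qed.

Lemma edges_on_connected l : is_line l -> edges_on tessellation l !=set0 ->
  connected (\bigcup_(e in edges_on tessellation l) e).
Proof.
move=> ll [e [eI el]]; have /inner_edgesP := eI.
case=> [[a [c [d [cd ac ai eE]]]]|[a [b [c [d [d' [cd dd' ab eE]]]]]]].
  rewrite eE in el eI.
  rewrite (vertical_edge_line cd ac ai ll el) (edges_on_vertical_line cd ac ai) bigcup_set1.
  have [[p [q [_ ->]]] _] := eI; exact: connected_segment.
rewrite eE in el eI.
rewrite (horizontal_edge_line cd dd' ab ll el) (edges_on_horizontal_line cd dd').
have [x1 [x2 [ax1 x12 x2b C1 C2]]] := horizontal_edge_points cd dd' ab.
have sub : cell a b d d `<=` cell lo hi d d.
  move=> p [Wp [_ pd]]; split=> //; split=> //.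
  by have := in_frame L Wp; lra.
have [|p [q [_ ->]]] := horizontal_cell_has_ends W_compact W_convex (sub _ C1) (sub _ C2).
  by lra.
exact: connected_segment.
Qed.

Lemma T_tessellation_tess : T_tessellation W tessellation.
Proof.
split; first exact: polygonal_tess.
  by move=> v; exact: T_shaped_tess.
move=> s1 s2 S1 S2 ne al; apply: ne.
exact: aligned_segments_eq edges_on_connected _ _ S1 S2 al.
Qed.

Lemma supporting_lines_tess : supporting_lines tessellation =
  [set l | (exists c a, [/\ c \in rows, c < hi, a \in cuts c, lo < a < hi & l = vertical_line a])
        \/ (exists d, [/\ d \in rows, lo < d < hi & l = horizontal_line d])].
Proof.
rewrite supporting_linesE; last exact: edges_on_connected.
apply/seteqP; split=> [l [ll [e [/inner_edgesP eI el]]]|l].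
  move: eI el => [[a [c [d [cd ac ai ->]]]]|
                  [a [b [c [d [d' [cd dd' ab ->]]]]]]] el.
    left; exists c, a; split=> //; first by case: cd.
      by case: cd => _ /rows_range + + _; lra.
    exact: (vertical_edge_line cd ac ai ll el).
  right; exists d; split; first by case: cd.
    exact: rows_between cd dd'.
  exact: (horizontal_edge_line cd dd' ab ll el).
case=> [[c [a [cR ch ac ai ->]]]|[d [dR di ->]]].
  have [d cd] := consecutive_succ cR (hi_rows L) ch.
  split; first exact: is_line_vertical.
  by exists (cell a a c d); rewrite (edges_on_vertical_line cd ac ai).
split; first exact: is_line_horizontal.
have [ld dh] := andP di.
have [c cd] := consecutive_pred dR (lo_rows L) ld.
have [d' dd'] := consecutive_succ dR (hi_rows L) dh.
have lh : lo < hi by lra.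
have [|||a [b [he la bh xab]]] := @horizontal_edge_through c d d' lo hi lo cd dd'.
- by rewrite mem_cat lo_cuts.
- by rewrite mem_cat hi_cuts.
- by rewrite lexx.
exists (cell a b d d); split; first by apply/inner_edgesP; right.
by move=> q [_ [/= _ ?]]; rewrite /horizontal_line/=; lra.
Qed.

End Tessellation.

(** The strip in which a vertical line is cut can be read off the tessellation, as
    the only edge on this line crosses that strip. *)
Lemma tess_cut_strip (R : realType) (W : set (plane R))
    (W_compact : compact W) (W_convex : convex_set W) (L L' : layout W) c c' a :
  lo L = lo L' -> hi L = hi L' -> rows L = rows L' -> tessellation L = tessellation L' ->
  c \in rows L -> c < hi L -> c' \in rows L' -> c' < hi L' ->
  a \in cuts L c -> a \in cuts L' c' -> lo L < a < hi L -> c = c'.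
Proof.
move=> loE hiE rE tE cR ch cR' ch' ac ac' ai.
have [d cd] := consecutive_succ cR (hi_rows L) ch.
have [d' cd'] := consecutive_succ cR' (hi_rows L') ch'.
have ai' : lo L' < a < hi L' by rewrite -loE -hiE.
have := edges_on_vertical_line W_compact W_convex cd ac ai.
rewrite tE (edges_on_vertical_line W_compact W_convex cd' ac' ai').
move=> /seteqP[/(_ _ erefl) /= E _].
have [y1 [y2 [cy1 y12 y2d C1 C2]]] := vertical_edge_points cd ac ai.
have [_ [_ /= y1']] : cell W a a c' d' (a, y1) by rewrite E.
rewrite -rE in cd'.
have y1cd : c < y1 < d by lra.
by have [] := consecutive_overlap cd cd' y1cd y1'.
Qed.

(** * Layouts given by a map from vertical lines to strips *)

(** The core is taken on one side of an interior point of [W], with half of the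
    available radius, so as to stay away from the sentinels. *)
Lemma frame_exists (R : realType) (W : set (plane R)) : compact W -> W° !=set0 ->
  exists lo hi xl xr yl yr : R,
  [/\ forall p, W p -> lo < p.1 < hi /\ lo < p.2 < hi,
      forall x y, xl < x < xr -> yl < y < yr -> W° (x, y),
      [/\ lo < xl, xl < xr & xr < hi] & [/\ lo < yl, yl < yr & yr < hi]].
Proof.
move=> cW [p pI].
have [r r0 rW] := (interior_planeP W° p).1 (nbhs_interior pI).
have [M [_ WM]] := compact_bounded cW.
have frame q : W q -> - (M + 1) < q.1 < M + 1 /\ - (M + 1) < q.2 < M + 1.
  move=> /(WM (M + 1/2) (ltac:(rewrite ltrDl; lra))) /=.
  rewrite [X in X <= _]/Num.norm/= ge_max !ler_norml => /andP[h1 h2].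
  by split; lra.
have Wr (s t : R) : `|s| < r -> `|t| < r -> W° (p.1 + s, p.2 + t).
  by move=> sr tr; apply: rW; rewrite /= addrAC subrr add0r.
have [h1 h2] := frame _ (interior_subset pI).
have r2 : `|r / 2| < r by rewrite ger0_norm; lra.
have [/= h3 h4] := frame _ (interior_subset (Wr _ _ r2 r2)).
exists (- (M + 1)), (M + 1), p.1, (p.1 + r / 2), p.2, (p.2 + r / 2); split=> //.
- move=> x y hx hy.
  have -> : (x, y) = (p.1 + (x - p.1), p.2 + (y - p.2)).
    by congr pair; rewrite addrC subrK.
  by apply: Wr; rewrite ltr_norml; lra.
- by split; lra.
- by split; lra.
Qed.

Lemma counting_ge_card (R : realType) (T : choiceType) (I : finType) (g : I -> T)
    (A : set T) : injective g -> (forall i, A (g i)) ->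
  ((#|I|%:R)%:E <= counting A :> \bar R)%E.
Proof.
move=> gI Ag; rewrite /counting; case: asboolP => [fA|_]; last exact: leey.
rewrite lee_fin ler_nat cardE -(size_map g).
apply: uniq_leq_size; first by rewrite map_inj_uniq ?enum_uniq.
by move=> _ /mapP[i _ ->]; rewrite in_fset_set// inE.
Qed.

Section Grid.
Context {R : realType} (W : set (plane R)).
Hypotheses (W_compact : compact W) (W_convex : convex_set W).
Variables (lo hi xl xr yl yr : R).
Hypothesis frame : forall p, W p -> lo < p.1 < hi /\ lo < p.2 < hi.
Hypothesis core : forall x y, xl < x < xr -> yl < y < yr -> W° (x, y).
Hypotheses (core_x : [/\ lo < xl, xl < xr & xr < hi])
           (core_y : [/\ lo < yl, yl < yr & yr < hi]).
Variables (m n : nat) (ys : 'I_m -> R) (xs : 'I_n -> R).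
Hypotheses (ys_inj : injective ys) (xs_inj : injective xs).
Hypotheses (ys_core : forall i, yl < ys i < yr) (xs_core : forall j, xl < xs j < xr).

(** Strips are designated by their lower side; [None] is the lowest strip, which
    has no horizontal line below it. *)
Definition strip_base (s : option 'I_m) : R := if s is Some i then ys i else lo.

Definition grid_rows : seq R := lo :: hi :: codom ys.

Definition grid_cuts (f : {ffun 'I_n -> option 'I_m}) (c : R) : seq R :=
  lo :: hi :: [seq xs j | j <- enum 'I_n & strip_base (f j) == c].

Lemma strip_base_inj : injective strip_base.
Proof.
have [? _ _] := core_y.
move=> [i|] [i'|] //=; first by move=> /ys_inj ->.
  by move=> E; exfalso; move: E (ys_core i); lra.
by move=> E; exfalso; move: E (ys_core i'); lra.
Qed.

Lemma strip_base_rows s : strip_base s \in grid_rows.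
Proof. by case: s => [i|]; rewrite !inE ?eqxx//= codom_f !orbT. Qed.

Lemma strip_base_hi s : strip_base s < hi.
Proof.
have [? ? ?] := core_y.
by case: s => [i|] /=; [have := ys_core i|]; lra.
Qed.

Lemma mem_grid_cuts f c x : x \in grid_cuts f c ->
  [\/ x = lo, x = hi | exists2 j, x = xs j & strip_base (f j) = c].
Proof.
rewrite !inE => /or3P[/eqP->|/eqP->|]; [by constructor 1|by constructor 2|].
by move=> /mapP[j]; rewrite mem_filter => /andP[/eqP fj _] ->; constructor 3; exists j.
Qed.

Lemma grid_cut f j : xs j \in grid_cuts f (strip_base (f j)).
Proof.
rewrite !inE; apply/orP; right; apply/orP; right; apply: map_f.
by rewrite mem_filter eqxx mem_enum.
Qed.

Fact grid_rows_core y : y \in grid_rows -> [|| y == lo, y == hi | yl < y < yr].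
Proof.
by rewrite !inE => /or3P[->|->|/codomP[i ->]]; rewrite ?ys_core ?orbT.
Qed.

Fact grid_cuts_core f c x : x \in grid_cuts f c ->
  [|| x == lo, x == hi | xl < x < xr].
Proof. by case/mem_grid_cuts => [->|->|[j -> _]]; rewrite ?eqxx ?xs_core ?orbT. Qed.

Fact grid_cuts_inj f c c' x : c \in grid_rows -> c' \in grid_rows ->
  x \in grid_cuts f c -> x \in grid_cuts f c' -> lo < x < hi -> c = c'.
Proof.
move=> _ _ /mem_grid_cuts[->|->|[j -> <-]]; [lra|lra|].
by move=> /mem_grid_cuts[->|->|[j' /xs_inj <- <-]] //; lra.
Qed.

Definition grid_layout (f : {ffun 'I_n -> option 'I_m}) : layout W.
Proof.
refine (@Layout R W lo hi xl xr yl yr grid_rows (grid_cuts f) frame core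
  core_x core_y _ _ _ _ grid_rows_core (@grid_cuts_core f) (@grid_cuts_inj f)).
- by rewrite mem_head.
- by rewrite !inE eqxx orbT.
- by move=> c; rewrite mem_head.
- by move=> c; rewrite !inE eqxx orbT.
Defined.

Definition grid_lines : set (set (plane R)) :=
  range (fun j => vertical_line (xs j)) `|` range (fun i => horizontal_line (ys i)).

Lemma supporting_lines_grid f :
  supporting_lines (tessellation (grid_layout f)) = grid_lines.
Proof.
have [[? ? ?] [? ? ?]] := (core_x, core_y).
rewrite supporting_lines_tess//; apply/seteqP; split=> l.
  case=> [[c [a [_ _ /mem_grid_cuts + ai ->]]]|[d [+ di ->]]].
    by case=> [aE|aE|[j -> _]]; [exfalso; move: ai; rewrite aE/=; lra..|left; exists j].
  rewrite /= !inE => /or3P[/eqP dE|/eqP dE|/codomP[i ->]].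
  - by exfalso; move: di; rewrite dE/=; lra.
  - by exfalso; move: di; rewrite dE/=; lra.
  - by right; exists i.
case=> [[j _ <-]|[i _ <-]]; [left|right].
  exists (strip_base (f j)), (xs j); split=> //.
  - exact: strip_base_rows.
  - exact: strip_base_hi.
  - exact: grid_cut.
  - by have := xs_core j; rewrite /=; lra.
exists (ys i); split=> //; first exact: (strip_base_rows (Some i)).
by have := ys_core i; rewrite /=; lra.
Qed.

Lemma tess_grid_inj : injective (fun f => tessellation (grid_layout f)).
Proof.
have [? ? ?] := core_x.
move=> f g fg; apply/ffunP => j; apply: strip_base_inj.
apply: (tess_cut_strip (L := grid_layout f) (L' := grid_layout g) (a := xs j)
  W_compact W_convex) => //=; try exact: strip_base_rows;
  try exact: strip_base_hi; try exact: grid_cut.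
by have := xs_core j; lra.
Qed.

Lemma is_line_grid l : grid_lines l -> is_line l.
Proof. by case=> [[? _ <-]|[? _ <-]]; [exact: is_line_vertical|exact: is_line_horizontal]. Qed.

Lemma vertical_line_inj : injective (@vertical_line R).
Proof. by move=> a b /seteqP[/(_ (a, 0)) + _]; apply. Qed.

Lemma horizontal_line_inj : injective (@horizontal_line R).
Proof. by move=> a b /seteqP[/(_ (0, a)) + _]; apply. Qed.

Lemma vertical_horizontal a b : vertical_line a <> horizontal_line b :> set (plane R).
Proof.
move=> /seteqP[/(_ (a, b + 1)) + _]; rewrite /vertical_line /horizontal_line/=.
by move=> /(_ erefl); lra.
Qed.

Lemma card_grid_lines : (grid_lines #= `I_(n + m))%card.
Proof.
pose g (t : 'I_(n + m)) := match fintype.split t with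
  | inl j => vertical_line (xs j) | inr i => horizontal_line (ys i) end.
have gI : injective g.
  move=> s t; rewrite /g => E; rewrite -[s]fintype.splitK -[t]fintype.splitK; move: E.
  case: (fintype.split s) => [j|i]; case: (fintype.split t) => [j'|i'].
  - by move=> /vertical_line_inj/xs_inj ->.
  - by move=> /vertical_horizontal.
  - by move=> /esym/vertical_horizontal.
  - by move=> /horizontal_line_inj/ys_inj ->.
have -> : grid_lines = range g.
  apply/seteqP; split=> [l [[j _ <-]|[i _ <-]]|_ [t _ <-]].
  - by exists (fintype.unsplit (inl j)) => //; rewrite /g fintype.unsplitK.
  - by exists (fintype.unsplit (inr i)) => //; rewrite /g fintype.unsplitK.
  - by rewrite /g; case: (fintype.split t) => [j|i]; [left; exists j|right; exists i].
apply: card_eq_trans (card_esym card_II).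
by apply: inj_card_eq => ? ? _ _; exact: gI.
Qed.

Lemma counting_grid :
  ((((m.+1) ^ n)%:R)%:E <= counting (T_tessellations_on W grid_lines) :> \bar R)%E.
Proof.
have -> : (m.+1 ^ n)%N = #|{ffun 'I_n -> option 'I_m}|.
  by rewrite card_ffun card_option !card_ord.
apply: counting_ge_card tess_grid_inj _ => f; split.
  exact: T_tessellation_tess.
exact: supporting_lines_grid.
Qed.

End Grid.

Lemma many_T_tessellations (R : realType) (W : set (plane R)) (m n : nat) :
  compact W -> convex_set W -> W° !=set0 ->
  exists2 L : set (set (plane R)), line_sets (n + m) L &
    ((((m.+1) ^ n)%:R)%:E <= counting (T_tessellations_on W L) :> \bar R)%E.
Proof.
move=> cW convW W0.
have [lo [hi [xl [xr [yl [yr [frame core cx cy]]]]]]] := frame_exists cW W0.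
have pts (u v : R) N : u < v ->
    exists2 s : 'I_N -> R, injective s & forall i, u < s i < v.
  move=> uv; exists (fun i => u + (v - u) / (i : nat).+2%:R).
    move=> i j /addrI /mulfI vu; apply/val_inj.
    have /vu/invr_inj/eqP : v - u != 0 by lra.
    by rewrite eqr_nat => /eqP[].
  move=> i; rewrite ltrDl divr_gt0 ?subr_gt0//= -ltrBrDl ltr_pdivrMr//.
  by rewrite ltr_pMr ?subr_gt0// ltr1n.
have [ys ys_inj ys_core] := pts _ _ m (ltac:(by case: cy) : yl < yr).
have [xs xs_inj xs_core] := pts _ _ n (ltac:(by case: cx) : xl < xr).
exists (grid_lines ys xs).
  split; last exact: card_grid_lines.
  exact: is_line_grid.
exact: (counting_grid cW convW frame core cx cy ys_inj xs_inj ys_core xs_core).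
Qed.

(** * The lower bound *)

(** For [k = 2] the integer part of [k / ln k] is not less than [k]: all lines are
    then horizontal, and the exponent on the left is non-positive. *)
Lemma grid_size_exists (R : realType) (k : nat) : (2 <= k)%N ->
  exists m n : nat, (n + m = k)%N /\
    (k%:R / ln k%:R) `^ (k%:R - k%:R / ln k%:R) <= ((m.+1) ^ n)%:R :> R.
Proof.
move=> k2.
set K : R := k%:R / ln k%:R.
have k0 : (0 : R) < k%:R by rewrite ltr0n; exact: ltn_trans k2.
have lnk : 0 < ln k%:R :> R by apply: ln_gt0; rewrite ltr1n.
have K1 : 1 <= K by rewrite ler_pdivlMr// mul1r ltW// ln_sublinear.
have K0 : 0 <= K by exact: le_trans ler01 K1.
have mK : (Num.truncn K)%:R <= K by rewrite truncn_le.
exists (minn k (Num.truncn K)), (k - minn k (Num.truncn K))%N; split.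
  by rewrite subnK// geq_minl.
have [kK|Kk] := leqP k (Num.truncn K).
  rewrite subnn expn0; apply: (@le_trans _ _ (K `^ 0)); last by rewrite powRr0.
  apply: ler_powR => //.
  by rewrite subr_le0; apply: (le_trans _ mK); rewrite ler_nat.
apply: (@le_trans _ _ (K `^ (k - Num.truncn K)%:R)).
  by apply: ler_powR => //; rewrite natrB ?(ltnW Kk)// lerD2l lerN2.
rewrite powR_mulrn// natrX lerXn2r ?nnegrE//.
by rewrite ltW// truncnS_gt.
Qed.

Theorem lemma5p1 (R : realType) (W : set (plane R))
    (W_compact : compact W) (W_convex : convex_set W) (W_int : W° !=set0)
    (k : nat) (k_ge2 : (2 <= k)%N) :
  (exists L : set (set (plane R)), line_sets k L /\
     (((k%:R / ln k%:R) `^ (k%:R - k%:R / ln k%:R))%:E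
        <= counting (T_tessellations_on W L) :> \bar R)%E) /\
  (((k%:R / ln k%:R) `^ (k%:R - k%:R / ln k%:R))%:E
     <= max_T_tessellations W k)%E.
Proof.
have [m [n [nm bound]]] := grid_size_exists R k_ge2.
have [L Lk count] := many_T_tessellations m n W_compact W_convex W_int.
rewrite nm in Lk.
have H := le_trans (bound : (_%:E <= _%:E)%E) count.
split; first by exists L.
apply: le_trans H _; apply: ereal_sup_ubound; by exists L.
Qed.
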